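(* Let $T\ge1$, let $S_a\subseteq\{0,\dots,T-1\}$ be a nonempty set of consecutive time steps (the anomaly event), with labels $\delta(t)=1$ if $t\in S_a$ and $\delta(t)=0$ otherwise, and let $w_N$ be a positive even integer (the island width). Let $y_{prf}$ be a perfect anomaly signal, i.e. one whose thresholded prediction $\hat y_{prf}:\{0,\dots,T-1\}\to\{0,1\}$ detects the anomaly event ($\hat y_{prf}(t)=1$ for some $t\in S_a$) and gives no false alarm ($\hat y_{prf}(t)=0$ for all $t\notin S_a$). Let $y_1=y_{prf}+f_k$ be a signal that triggers in addition $k\ge1$ false alarms, i.e. its thresholded prediction $\hat y_1$ agrees with $\hat y_{prf}$ except that $\hat y_1(t)=1$ at $k$ time steps $t\notin S_a$. Then $$F_{1BA}(\delta,\hat y_{prf,BA})=1\qquad\text{and}\qquad F_{1BA}(\delta,\hat y_{1,BA})=1-\epsilon\ \text{ for some }\epsilon>0 .$$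
   Context: Balanced adjustment (BA) of a binary prediction $\hat y$: for each false positive time step $u$ (i.e. $\hat y(u)=1$, $\delta(u)=0$) let $S_N(u)=\{k: u-\frac{w_N}{2}+1\le k\le u+\frac{w_N}{2}\}\cap\{0,\dots,T-1\}$. The adjusted prediction is $\hat y_{BA}(t)=1$ if $\hat y(t)=1$; or if $t\in S_a$ and there is $t'\in S_a$ with $\hat y(t')=1$; or if $t\in S_N(u)$ for some false positive time step $u$; otherwise $\hat y_{BA}(t)=0$. $F_{1BA}(\delta,\hat y_{BA})$ is the usual F1 score (harmonic mean of precision and recall, over the time steps $0,\dots,T-1$) of the prediction $\hat y_{BA}$ against the true labels $\delta$. *)

(* Defs.v *)
From mathcomp Require Import all_boot all_order all_algebra.

Set Implicit Arguments.
Unset Strict Implicit.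
Unset Printing Implicit Defensive.

Import Order.TTheory GRing.Theory Num.Theory.

Local Open Scope nat_scope.

(* Labels and predictions take the values true / false for 1 / 0. *)

Definition consecutive (T : nat) (S : {set 'I_T}) : Prop :=
  exists a b : nat, S = [set t : 'I_T | a <= t <= b].

Definition label (T : nat) (Sa : {set 'I_T}) : 'I_T -> bool :=
  fun t => t \in Sa.

Definition true_pos (T : nat) (delta y : 'I_T -> bool) : nat :=
  #|[set t | delta t & y t]|.

Definition false_pos (T : nat) (delta y : 'I_T -> bool) : nat :=
  #|[set t | ~~ delta t & y t]|.

Definition false_neg (T : nat) (delta y : 'I_T -> bool) : nat :=
  #|[set t | delta t & ~~ y t]|.

(* A score whose denominator vanishes is 0, since x / 0 = 0 in a field. *)

Definition precision (R : realFieldType) (T : nat) (delta y : 'I_T -> bool) : R :=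
  ((true_pos delta y)%:R / (true_pos delta y + false_pos delta y)%N%:R)%R.

Definition recall (R : realFieldType) (T : nat) (delta y : 'I_T -> bool) : R :=
  ((true_pos delta y)%:R / (true_pos delta y + false_neg delta y)%N%:R)%R.

Definition F1 (R : realFieldType) (T : nat) (delta y : 'I_T -> bool) : R :=
  let p := precision R delta y in
  let r := recall R delta y in
  (2%:R * p * r / (p + r))%R.

(* The lower bound u - wN/2 + 1 <= k is written without subtraction, which
   would be truncated at 0. *)
Definition island (T wN : nat) (u : 'I_T) : {set 'I_T} :=
  [set k : 'I_T | (u + 1 <= k + wN./2) && (k <= u + wN./2)].

Definition balanced_adjust (T wN : nat) (Sa : {set 'I_T})
    (y : 'I_T -> bool) : 'I_T -> bool :=
  fun t => [|| y t,
               (t \in Sa) && [exists t' in Sa, y t']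
             | [exists u, [&& y u, ~~ label Sa u & t \in island wN u]]].

Definition perfect_prediction (T : nat) (Sa : {set 'I_T})
    (y : 'I_T -> bool) : Prop :=
  (exists2 t, t \in Sa & y t) /\ (forall t, t \notin Sa -> y t = false).

Definition adds_false_alarms (T : nat) (Sa : {set 'I_T}) (k : nat)
    (y y1 : 'I_T -> bool) : Prop :=
  exists F : {set 'I_T},
    [/\ #|F| = k,
        forall t, t \in F -> t \notin Sa,
        forall t, t \in F -> y1 t = true
      & forall t, t \notin F -> y1 t = y t].

(* Main.v *)
Require Import Defs.
From mathcomp Require Import all_boot all_order all_algebra.
From mathcomp Require Import ring lra.

Set Implicit Arguments.
Unset Strict Implicit.
Unset Printing Implicit Defensive.

Import Order.TTheory GRing.Theory Num.Theory.

Local Open Scope nat_scope.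

(** Once a single point of the event is detected, the adjustment fills the whole event, so recall is
    1. With [m > 0] true positives and [f] false positives, F1 is then
    [2m / (2m + f) = 1 - f / (2m + f)] ([F1_full_recall]). The score thus depends on whether [f]
    vanishes: it does for a perfect prediction, and it does not once there is a false alarm. *)

Lemma F1_full_recall (R : realFieldType) (T : nat) (delta y : 'I_T -> bool) :
  0 < true_pos delta y -> false_neg delta y = 0 ->
  F1 R delta y = (1 - (false_pos delta y)%:R /
    ((true_pos delta y)%:R *+ 2 + (false_pos delta y)%:R))%R.
Proof.
move=> tp_gt0 fn0; rewrite /F1 /precision /recall fn0 addn0 natrD.
have : (0 < (true_pos delta y)%:R :> R)%R by rewrite ltr0n.
have : (0 <= (false_pos delta y)%:R :> R)%R by rewrite ler0n.
move: (_%:R)%R (_%:R)%R => f m f_ge0 m_gt0.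
(* The denominators cleared here are nonzero because [m > 0] and [f >= 0]. *)
by field; repeat (apply/andP; split); apply: lt0r_neq0; lra.
Qed.

Section DetectedEvent.

Variables (T wN : nat) (Sa : {set 'I_T}) (y : 'I_T -> bool) (t0 : 'I_T).
Hypotheses (t0Sa : t0 \in Sa) (yt0 : y t0).

Lemma balanced_adjust_event t : t \in Sa -> balanced_adjust wN Sa y t.
Proof.
move=> tSa; rewrite /balanced_adjust tSa /=.
by apply/or3P; apply: Or32; apply/existsP; exists t0; rewrite t0Sa.
Qed.

Lemma true_pos_balanced_adjust_gt0 :
  0 < true_pos (label Sa) (balanced_adjust wN Sa y).
Proof.
by apply/card_gt0P; exists t0; rewrite inE /label t0Sa balanced_adjust_event.
Qed.

Lemma false_neg_balanced_adjust :
  false_neg (label Sa) (balanced_adjust wN Sa y) = 0.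
Proof.
apply: eq_card0 => t; rewrite !inE /label.
by case: (boolP (t \in Sa)) => //= tSa; rewrite balanced_adjust_event.
Qed.

End DetectedEvent.

(** Without a false alarm no island arises, so every point that the adjustment adds lies in [Sa]. *)
Lemma false_pos_balanced_adjust_perfect (T wN : nat) (Sa : {set 'I_T})
    (y : 'I_T -> bool) :
  (forall t, t \notin Sa -> y t = false) ->
  false_pos (label Sa) (balanced_adjust wN Sa y) = 0.
Proof.
move=> y0; apply: eq_card0 => t; rewrite !inE /label /balanced_adjust.
case: (boolP (t \in Sa)) => //= tSa; rewrite y0 //=.
by apply/existsP => -[u /and3P[yu uSa _]]; rewrite y0 in yu.
Qed.

(** The adjustment only adds points, so the false alarm [u] itself survives it. *)
Lemma false_pos_balanced_adjust_gt0 (T wN : nat) (Sa : {set 'I_T})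
    (y : 'I_T -> bool) (u : 'I_T) :
  u \notin Sa -> y u ->
  0 < false_pos (label Sa) (balanced_adjust wN Sa y).
Proof.
move=> uSa yu; apply/card_gt0P; exists u.
by rewrite inE /label uSa /balanced_adjust yu.
Qed.

Theorem lemma2p4 (R : realFieldType) (T : nat) (Sa : {set 'I_T}) (wN k : nat)
    (yprf y1 : 'I_T -> bool)
    (hT : 1 <= T)
    (hSa0 : Sa != set0) (hSa : consecutive Sa)
    (hwN : 0 < wN) (hwNeven : ~~ odd wN)
    (hprf : perfect_prediction Sa yprf)
    (hk : 1 <= k) (hy1 : adds_false_alarms Sa k yprf y1) :
  (F1 R (label Sa) (balanced_adjust wN Sa yprf) = 1)%R /\
  (exists eps : R,
     (0 < eps)%R /\ (F1 R (label Sa) (balanced_adjust wN Sa y1) = 1 - eps)%R).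
Proof.
have [[t0 t0Sa yt0] y0] := hprf.
have [F [cardF FSa y1F y1NF]] := hy1.
(* The added alarms avoid [Sa], so the detection at [t0] carries over to [y1]. *)
have y1t0 : y1 t0.
  by rewrite y1NF //; apply/negP => /FSa; rewrite t0Sa.
have [u uF] : exists u, u \in F by apply/card_gt0P; rewrite cardF.
have fp_gt0 := false_pos_balanced_adjust_gt0 wN (FSa u uF) (y1F u uF).
have tp_gt0 := true_pos_balanced_adjust_gt0 wN t0Sa y1t0.
split.
  rewrite F1_full_recall.
  - by rewrite false_pos_balanced_adjust_perfect // mul0r subr0.
  - exact: true_pos_balanced_adjust_gt0 yt0.
  - exact: false_neg_balanced_adjust yt0.
rewrite F1_full_recall //; last exact: false_neg_balanced_adjust y1t0.
(* Unification reads off [eps] as [f / (2m + f)], positive since [f] and [m] are. *)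
eexists; split; last by [].
by rewrite divr_gt0 ?addr_gt0 ?mulrn_wgt0 ?pmulrn_lgt0 ?ltr0n.
Qed.
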